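(* Let $n\ge 1$. For $1\le i\le n$, the characteristic polynomial of the poset $\Pi^A_{n,i}$ is $$\chi^A_{n,i}(x)=(x-i)(x-n)^{n-1-i},$$ and its constant term is $(-1)^{n-i}\, i\, n^{n-1-i}$. (For $i=n$ the expression $(x-n)(x-n)^{-1}$ is read as $1$.) The characteristic polynomial of $\Pi^A_n$ is $$\chi^A_n(x)=(x-n)^{n-1}.$$
   Context: Write $[n]=\{1,\dots,n\}$. A pointed partition of $[n]$ is a partition of $[n]$ into non-empty blocks together with the choice of one element in each block, called the pointed element of this block. The poset $\Pi^A_n$ is the set of all pointed partitions of $[n]$, with $\pi\le\nu$ if and only if the underlying partition of $\pi$ refines that of $\nu$ and the set of pointed elements of $\pi$ contains the set of pointed elements of $\nu$. It has a minimal element $\hat 0$ (all blocks singletons), and the rank of $\pi$ is $n$ minus the number of blocks of $\pi$. For $1\le i\le n$, $\Pi^A_{n,i}$ is the subposet (with the induced order) of pointed partitions of $[n]$ in which all elements of $[i]$ are pointed; it has rank $n-i$. For a pure finite poset $\Pi$ with minimal element $\hat 0$, rank function $\operatorname{rk}$ and maximal elements of rank $r$, the characteristic polynomial is $\chi(x)=\sum_{a\in\Pi}\mu(a)\,x^{r-\operatorname{rk}(a)}$, where $\mu(a)=\mu(\hat 0,a)$ is the Möbius function of $\Pi$. *)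

(* Defs.v *)
From HB Require Import structures.
From mathcomp Require Import all_boot all_order all_algebra.

Set Implicit Arguments.
Unset Strict Implicit.
Unset Printing Implicit Defensive.

Import Order.TTheory GRing.Theory.

Section FinitePosets.

Local Open Scope order_scope.

Context {d : Order.disp_t}.

Section Moebius.

Variable T : finPOrderType d.

(* [k] bounds the recursion depth. The depth reached from [y] is at most the
   number of elements below [y], so [#|T|] is always enough; see [mobiusE]. *)
Fixpoint mobius_rec (k : nat) (x y : T) : int :=
  if x == y then 1%R
  else if k is k'.+1 then (- \sum_(z : T | (x <= z)%O && (z < y)%O) mobius_rec k' x z)%R
  else 0%R.

Definition mobius (x y : T) : int := mobius_rec #|T| x y.

Lemma mobius_rec_fuel (k l : nat) (x y : T) :
  (#|[set z : T | (z < y)%O]| <= k)%N -> (#|[set z : T | (z < y)%O]| <= l)%N ->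
  mobius_rec k x y = mobius_rec l x y.
Proof.
elim: k l x y => [|k IHk] l x y.
  rewrite leqn0 cards_eq0 => /eqP y0 _; case: l => //= l.
  case: (x == y) => //; rewrite big_pred0 ?GRing.oppr0 // => z.
  by have := in_set0 z; rewrite -y0 inE => ->; rewrite andbF.
case: l => [_|l hk hl] /=.
  rewrite leqn0 cards_eq0 => /eqP y0.
  case: (x == y) => //; rewrite big_pred0 ?GRing.oppr0 // => z.
  by have := in_set0 z; rewrite -y0 inE => ->; rewrite andbF.
case: (x == y) => //; congr (- _)%R; apply: eq_bigr => z /andP[_ zy].
have h : (#|[set t : T | (t < z)%O]| < #|[set t : T | (t < y)%O]|)%N.
  apply/proper_card/properP; split.
    by apply/subsetP => t; rewrite !inE => tz; apply: lt_trans tz zy.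
  by exists z; rewrite inE ?ltxx.
by apply: IHk; rewrite -ltnS; [apply: leq_trans h hk|apply: leq_trans h hl].
Qed.

Lemma mobiusE (x y : T) :
  mobius x y = if x == y then 1%R
               else (- \sum_(z : T | (x <= z)%O && (z < y)%O) mobius x z)%R.
Proof.
rewrite /mobius (@mobius_rec_fuel #|T| #|T|.+1) /=; first by [].
  exact: max_card.
exact: leq_trans (max_card _) (leqnSn _).
Qed.

End Moebius.

Section CharacteristicPolynomial.

Variable T : finBPOrderType d.

Definition is_chain (C : {set T}) : bool :=
  [forall x in C, forall y in C, x >=< y].

(* The length of a longest chain from [\bot] to [a] ([a] itself not counted);
   in a pure poset all maximal such chains have the same length. *)
Definition rank (a : T) : nat :=
  \max_(C : {set T} | is_chain C && [forall x in C, x < a]) #|C|.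

(* In a pure poset, the common rank of the maximal elements. *)
Definition poset_rank : nat := \max_(a : T) rank a.

Definition characteristic_poly : {poly int} :=
  (\sum_(a : T) mobius \bot a *: 'X^(poset_rank - rank a))%R.

End CharacteristicPolynomial.

End FinitePosets.

Arguments characteristic_poly {d} T.

(* The set [n] = {1, ..., n} is encoded as ['I_n] = {0, ..., n - 1}, so that
   [j : 'I_n] stands for j + 1. A pointed partition is a pair of a partition
   and of the set of its pointed elements, which meets each block exactly
   once. *)
Section PointedPartitions.

Variable n : nat.

Definition is_pointed_partition (p : {set {set 'I_n}} * {set 'I_n}) : bool :=
  partition p.1 [set: 'I_n] && is_transversal p.2 p.1 [set: 'I_n].

Record pointed_partition : Type := PointedPartition {
  pp_val :> {set {set 'I_n}} * {set 'I_n};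
  pp_valP : is_pointed_partition pp_val
}.

HB.instance Definition _ := [isSub for pp_val].
HB.instance Definition _ := [Finite of pointed_partition by <:].

Definition blocks (p : pointed_partition) : {set {set 'I_n}} := (val p).1.
Definition pointed (p : pointed_partition) : {set 'I_n} := (val p).2.

Definition refines (P Q : {set {set 'I_n}}) : bool :=
  [forall B in P, exists C in Q, B \subset C].

Definition pp_le (p q : pointed_partition) : bool :=
  refines (blocks p) (blocks q) && (pointed q \subset pointed p).

Lemma blocks_partition (p : pointed_partition) :
  partition (blocks p) [set: 'I_n].
Proof. by have /andP[] := pp_valP p. Qed.

Lemma refines_refl : reflexive refines.
Proof.
by move=> P; apply/forall_inP => B BP; apply/exists_inP; exists B.
Qed.

Lemma refines_trans : transitive refines.
Proof.
move=> Q P R /forall_inP PQ /forall_inP QR; apply/forall_inP => B BP.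
have [C CQ BC] := exists_inP (PQ B BP).
have [D DR CD] := exists_inP (QR C CQ).
by apply/exists_inP; exists D; rewrite ?(subset_trans BC).
Qed.

Lemma refines_sub (P Q : {set {set 'I_n}}) (D : {set 'I_n}) :
  partition P D -> refines P Q -> refines Q P -> P \subset Q.
Proof.
case/and3P => _ tP P0 /forall_inP PQ /forall_inP QP.
apply/subsetP => B BP.
have [C CQ BC] := exists_inP (PQ B BP).
have [B' B'P CB'] := exists_inP (QP C CQ).
have [x xB] : exists x, x \in B.
  by apply/set0Pn; apply: contraNneq P0 => <-.
have xB' : x \in B' by apply/(subsetP CB')/(subsetP BC).
have eB : B' = B by rewrite -(def_pblock tP BP xB) (def_pblock tP B'P xB').
by have -> : B = C by apply/eqP; rewrite eqEsubset BC -eB.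
Qed.

Lemma pp_le_refl : reflexive pp_le.
Proof. by move=> p; rewrite /pp_le refines_refl subxx. Qed.

Lemma pp_le_anti : antisymmetric pp_le.
Proof.
move=> p q /andP[/andP[pq sqp] /andP[qp spq]]; apply: val_inj.
rewrite [val p]surjective_pairing [val q]surjective_pairing; congr pair.
  apply/eqP; rewrite eqEsubset.
  by rewrite (refines_sub (blocks_partition p)) ?(refines_sub (blocks_partition q)).
by apply/eqP; rewrite eqEsubset; apply/andP.
Qed.

Lemma pp_le_trans : transitive pp_le.
Proof.
move=> q p r /andP[pq sqp] /andP[qr srq].
by rewrite /pp_le (refines_trans pq qr) (subset_trans srq sqp).
Qed.

Fact pp_display : Order.disp_t. Proof. exact: Order.Disp tt tt. Qed.

HB.instance Definition _ := Order.Le_isPOrder.Build pp_display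
  pointed_partition pp_le_refl pp_le_anti pp_le_trans.

Definition singletons : {set {set 'I_n}} := [set [set j] | j : 'I_n].

Lemma singletons_partition : partition singletons [set: 'I_n].
Proof.
apply/and3P; split.
- apply/eqP/setP => x; rewrite inE; apply/bigcupP.
  by exists [set x]; rewrite ?set11 ?imset_f.
- apply/trivIsetP => _ _ /imsetP[x _ ->] /imsetP[y _ ->] xy.
  by rewrite disjoints1 inE; apply: contra xy => /eqP ->.
- by apply/imsetP => -[x _] /setP/(_ x); rewrite !inE eqxx.
Qed.

Lemma singletons_pointed : is_pointed_partition (singletons, [set: 'I_n]).
Proof.
rewrite /is_pointed_partition /is_transversal /= singletons_partition subxx /=.
by apply/forall_inP => _ /imsetP[x _ ->]; rewrite setTI cards1.
Qed.

Definition pp_bot : pointed_partition := PointedPartition singletons_pointed.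

Lemma pp_le0x (p : pointed_partition) : (pp_bot <= p)%O.
Proof.
change (pp_le pp_bot p); rewrite /pp_le subsetT andbT.
apply/forall_inP => _ /imsetP[x _ ->]; apply/exists_inP.
have [/eqP cP _ _] := and3P (blocks_partition p).
have /bigcupP[B BP xB] : x \in cover (blocks p) by rewrite cP inE.
by exists B; rewrite ?sub1set.
Qed.

HB.instance Definition _ :=
  Order.hasBottom.Build pp_display pointed_partition pp_le0x.

Section Restricted.

Variable i : nat.

(* [j < i] for [j : 'I_n] says that j + 1 is in [i] = {1, ..., i}. *)
Definition first_pointed (p : pointed_partition) : bool :=
  [set j : 'I_n | (j < i)%N] \subset pointed p.

Record pointed_partition_in : Type := PointedPartitionIn {
  ppi_val :> pointed_partition;
  ppi_valP : first_pointed ppi_val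
}.

HB.instance Definition _ := [isSub for ppi_val].
HB.instance Definition _ := [Finite of pointed_partition_in by <:].
HB.instance Definition _ :=
  [SubChoice_isSubPOrder of pointed_partition_in by <: with pp_display].

Lemma first_pointed_bot : first_pointed pp_bot.
Proof. exact: subsetT. Qed.

Definition ppi_bot : pointed_partition_in :=
  PointedPartitionIn first_pointed_bot.

Lemma ppi_le0x (p : pointed_partition_in) : (ppi_bot <= p)%O.
Proof. by rewrite leEsub; apply: pp_le0x. Qed.

HB.instance Definition _ :=
  Order.hasBottom.Build pp_display pointed_partition_in ppi_le0x.

End Restricted.

End PointedPartitions.

(* Main.v *)
(* A pointed partition of U is the idempotent map sending each element to the
   pointed element of its block; the order becomes p <= q iff qp = q = pq
   ([below p q]). Forests are the self-maps p all of whose orbits end in a fixed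
   point (a root); [sink_map p] sends each vertex to its root. A sign-reversing
   involution shows that the forests p with p <= a, weighted by
   (-1)^(number of edges), sum to 0 unless a is the bottom element. Hence
   mu(a) = (-1)^(rk a) #{forests p with sink_map p = a}, and the characteristic
   polynomial of the posets is a signed sum over forests. The number e(B) of
   forests on N vertices with set of roots B satisfies
   (|S| + 1) e(S) = N |S| e(S + v): redirect the root v to any vertex outside
   its tree, the mean size of which is N / (|S| + 1) by symmetry. So
   N e(B) = |B| N^(N - |B|), and the binomial formula concludes. *)
Require Import Defs.
From mathcomp Require Import all_boot all_order all_algebra.
From mathcomp Require Import all_fingroup zify ring.

Import Order.TTheory GRing.Theory Num.Theory.
Local Open Scope ring_scope.

Set Implicit Arguments.
Unset Strict Implicit.
Unset Printing Implicit Defensive.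

(** * Forests as self-maps, and redirection of one edge *)

Section Forests.

Variable T : finType.
Implicit Types (p q a : {ffun T -> T}) (x y u v : T) (B S : {set T}).

(** An orbit that reaches a fixed point does so within [#|T|] steps and then stays there, so this is
    the root of [x] whenever there is one. *)
Definition sink p x : T := iter #|T| p x.

Definition forest p : bool := [forall x, p (sink p x) == sink p x].

Definition fixset p : {set T} := [set x | p x == x].

Definition redirect p v u : {ffun T -> T} := [ffun x => if x == v then u else p x].

Lemma sink_iter p x k : p (iter k p x) = iter k p x -> sink p x = iter k p x.
Proof.
move=> fixk; have con : fconnect p x (iter k p x) by apply: fconnect_iter.
have lt : (findex p x (iter k p x) <= #|T|)%N.
  by apply: ltnW; apply: leq_trans (findex_max con) (max_card _).
rewrite /sink -(subnK lt) iterD iter_findex //. exact: iter_fix.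
Qed.

Lemma forestP p : reflect (forall x, exists k, p (iter k p x) = iter k p x) (forest p).
Proof.
apply: (iffP forallP) => [fp x|fp x]; first by exists #|T|; apply/eqP/fp.
by have [k kE] := fp x; rewrite (sink_iter kE) kE.
Qed.

Lemma sink_fixed p x : forest p -> p (sink p x) = sink p x.
Proof. by move=> /forallP /(_ x) /eqP. Qed.

Lemma fixed_sink p x : p x = x -> sink p x = x.
Proof. exact: iter_fix. Qed.

Lemma sink_next p x : forest p -> sink p (p x) = sink p x.
Proof. by move=> fp; rewrite /sink -iterSr iterS; apply: sink_fixed. Qed.

Lemma sink_ind p (P : T -> Prop) :
  forest p -> (forall x, p x = x -> P x) ->
  (forall x, P (p x) -> P x) -> forall x, P x.
Proof.
move=> /forestP fp Pfix Pnext x; have [k] := fp x.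
elim: k x => [|k IH] x; first exact: Pfix.
by rewrite iterSr => kE; apply/Pnext/IH.
Qed.

(** After [#|T|] rounds of the cycle the path is back at [x], but it has also reached the fixed
    point [sink p x] and stayed there. *)
Lemma forest_acyclic p x k : forest p -> iter k.+1 p x = x -> p x = x.
Proof.
move=> fp cyc; have cycm m : iter (m * k.+1) p x = x.
  by elim: m => // m IH; rewrite mulSn iterD IH.
have := cycm #|T|; rewrite mulnS addnC iterD -/(sink p x).
by rewrite iter_fix => [<-|]; apply: sink_fixed.
Qed.

Lemma exists_next p x :
  (exists k, p (iter k p (p x)) = iter k p (p x)) ->
  exists k, p (iter k p x) = iter k p x.
Proof. by move=> [k kE]; exists k.+1; rewrite iterSr. Qed.

Lemma redirect_eq p v u : redirect p v u v = u.
Proof. by rewrite ffunE eqxx. Qed.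

Lemma redirect_neq p v u x : x != v -> redirect p v u x = p x.
Proof. by rewrite ffunE => /negbTE ->. Qed.

Lemma redirect_redirect p v u w : redirect (redirect p v u) v w = redirect p v w.
Proof. by apply/ffunP => x; rewrite !ffunE; case: eqP. Qed.

Lemma redirect_id p v : redirect p v (p v) = p.
Proof. by apply/ffunP => x; rewrite ffunE; case: eqP => // ->. Qed.

(** The [p]-path from [u] avoids the fixed point [v], otherwise it would end there. So it survives
    the redirection, and paths reaching [v] continue along it. *)
Lemma forest_attach p v u :
  forest p -> p v = v -> sink p u != v -> forest (redirect p v u).
Proof.
move=> fp pv uv; set q := redirect p v u.
have reach_u : exists k, q (iter k q u) = iter k q u.
  have/(_ #|T|) stay k : iter k q u = iter k p u.
    elim: k => //= k ->; rewrite redirect_neq //.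
    apply: contra_neq uv => kE; rewrite -kE; apply: sink_iter.
    by rewrite kE.
  exists #|T|; rewrite stay redirect_neq //; exact: sink_fixed.
have reach_v : exists k, q (iter k q v) = iter k q v.
  by apply: exists_next; rewrite /q redirect_eq.
apply/forestP; apply: (sink_ind fp) => x; have [->//|xv] := eqVneq x v.
  by move=> px; exists 0; rewrite /= redirect_neq.
by move=> reach; apply: exists_next; rewrite {2 4}/q redirect_neq.
Qed.

Lemma forest_cut p v : forest p -> forest (redirect p v v).
Proof.
move=> fp; apply/forestP; apply: (sink_ind fp) => x; have [->|xv] := eqVneq x v.
- by exists 0; rewrite /= redirect_eq.
- by move=> px; exists 0; rewrite /= redirect_neq.
- by exists 0; rewrite /= redirect_eq.
by move=> reach; apply: exists_next; rewrite (redirect_neq _ _ xv).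
Qed.

(** If the path from [p v] ended at [v] after the cut, [p] would have a cycle through [v]. *)
Lemma sink_cut p v : forest p -> p v != v -> sink (redirect p v v) (p v) != v.
Proof.
move=> fp; apply: contra_neq; rewrite /sink.
set q := redirect p v v => qE.
suff [k kE] : exists k, iter k p (p v) = v.
  by apply: (forest_acyclic (k := k) fp); rewrite iterSr.
elim: #|T| (p v) qE => [|k IH] x; first by exists 0.
have [->|xv] := eqVneq x v; first by exists 0.
rewrite iterSr redirect_neq // => /IH[j jE].
by exists j.+1; rewrite iterSr.
Qed.

(** * Counting forests with a prescribed set of roots *)

Definition roots_forests B : {set {ffun T -> T}} := [set p | forest p & fixset p == B].

(** Cutting the edge out of [v] maps forests with roots [S] bijectively to pairs of a forest with
    the extra root [v] and a vertex [u] outside the tree of [v]; attaching [v] to [u] is the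
    inverse. *)
Lemma card_forests_attach S v : v \notin S ->
  #|roots_forests S| =
  (\sum_(p in roots_forests (v |: S)) #|[set u | sink p u != v]|)%N.
Proof.
move=> vS; under eq_bigr => p _ do rewrite -sum1_card.
rewrite pair_big_dep /= -sum1_card.
rewrite (reindex_onto (fun pu => redirect pu.1 v pu.2)
  (fun p => (redirect p v v, p v))) /=; last first.
  by move=> p _; rewrite redirect_redirect redirect_id.
apply: eq_bigl => -[p u] /=; rewrite redirect_redirect redirect_eq xpair_eqE eqxx andbT !inE.
have -> : (redirect p v v == p) = (p v == v).
  apply/eqP/eqP => [<-|pv]; first by rewrite redirect_eq.
  by rewrite -[in RHS](redirect_id p v) pv.
have [pv|pv] /= := eqVneq (p v) v; last first.
  rewrite andbF; symmetry; apply/negbTE; apply: contra pv => /andP[/andP[_ /eqP/setP/(_ v)]].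
  by rewrite !inE eqxx => /eqP ->.
rewrite andbT; apply/andP/andP => -[].
  move=> fq /eqP/setP qS; have uv : u != v.
    by move: (qS v); rewrite inE redirect_eq (negbTE vS) => ->.
  have eqp : redirect (redirect p v u) v v = p.
    by rewrite redirect_redirect -{2}pv redirect_id.
  have qv : redirect p v u v != v by rewrite redirect_eq.
  have := sink_cut fq qv; rewrite eqp redirect_eq => ->.
  have := forest_cut v fq; rewrite eqp => ->; split=> //=.
  apply/eqP/setP => x; rewrite !inE.
  have [->|xv] /= := eqVneq x v; first by rewrite pv eqxx.
  by rewrite -qS inE redirect_neq.
move=> /andP[fp /eqP/setP pS] su; rewrite forest_attach //; split=> //.
have uv : u != v by apply: contra su => /eqP ->; rewrite fixed_sink.
apply/eqP/setP => x; rewrite !inE.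
have [->|xv] /= := eqVneq x v; first by rewrite redirect_eq (negbTE uv) (negbTE vS).
by move: (pS x); rewrite !inE (negbTE xv) redirect_neq.
Qed.

Definition conj_ffun (s : {perm T}) p : {ffun T -> T} := [ffun x => s (p (s^-1%g x))].

Lemma iter_conj s p k x : iter k (conj_ffun s p) x = s (iter k p (s^-1%g x)).
Proof. by elim: k => [|k /= ->]; rewrite ?permKV // ffunE permK. Qed.

(** Conjugation by the transposition of [v] and [w] preserves the root set [B] and exchanges the
    trees of these two roots. *)
Lemma sum_tree_size_sym B v w : v \in B -> w \in B ->
  (\sum_(p in roots_forests B) #|[set u | sink p u == v]| =
   \sum_(p in roots_forests B) #|[set u | sink p u == w]|)%N.
Proof.
move=> vB wB; pose t := tperm v w.
have tK : (t^-1 = t)%g by rewrite /t tpermV.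
rewrite (reindex (conj_ffun t)) /=; last first.
  exists (conj_ffun t) => p _; apply/ffunP => x; rewrite !ffunE tK /t !tpermK //.
have sinkE p x : sink (conj_ffun t p) x = t (sink p (t x)).
  by rewrite /sink iter_conj tK.
have tB x : (t x \in B) = (x \in B).
  rewrite /t; case: tpermP => [->|->|//]; by rewrite vB wB.
apply: eq_big => [p|p _].
  rewrite !inE; congr andb.
    apply/forallP/forallP => fp x; have := fp (t x).
      by rewrite sinkE ffunE tK /t !tpermK (inj_eq perm_inj).
    by rewrite sinkE ffunE tK /t tpermK (inj_eq perm_inj) => /eqP ->.
  apply/eqP/eqP => [/setP fB|fB]; apply/setP => x.
    by have := fB (t x); rewrite !inE ffunE tK tB /t tpermK (inj_eq perm_inj).
  by rewrite -tB -fB !inE ffunE tK -(inj_eq (@perm_inj _ t)) /t tpermK.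
rewrite -(card_imset _ (@perm_inj _ t)); apply: eq_card => x.
rewrite -{1}(tpermK v w x) -/t mem_imset; last exact: perm_inj.
by rewrite !inE sinkE /t tpermK (can2_eq (tpermK v w) (tpermK v w)) tpermL.
Qed.

Lemma card_forests_step S v : v \notin S ->
  (#|S|.+1 * #|roots_forests S| = #|T| * #|S| * #|roots_forests (v |: S)|)%N.
Proof.
move=> vS; set B := v |: S; set E := #|roots_forests B|.
set t := (\sum_(p in roots_forests B) #|[set u | sink p u == v]|)%N.
have sumT : (#|roots_forests S| + t = #|T| * E)%N.
  rewrite (card_forests_attach vS) -big_split /= /E [RHS]mulnC -sum_nat_const.
  apply: eq_bigr => p _; rewrite -cardsT -(cardsID [set u | sink p u == v] setT) addnC.
  by congr addn; apply: eq_card => u; rewrite !inE ?andbT.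
(* All [#|B|] roots have the same total tree size [t], and the trees of each forest partition
   [T]. *)
have sumt : (#|S|.+1 * t = #|T| * E)%N.
  have -> : (#|S|.+1 = #|B|)%N by rewrite cardsU1 vS.
  rewrite -sum_nat_const (eq_bigr (fun w =>
    \sum_(p in roots_forests B) #|[set u | sink p u == w]|)%N); last first.
    by move=> w wB; apply: sum_tree_size_sym; rewrite // /B setU11.
  rewrite exchange_big /= /E [RHS]mulnC -[RHS]sum_nat_const; apply: eq_bigr => p.
  rewrite inE => /andP[fp /eqP fB]; rewrite -cardsT -sum1_card.
  rewrite [RHS](partition_big (sink p) (mem B)) /=; last first.
    by move=> u _; rewrite -fB inE sink_fixed.
  apply: eq_bigr => w _; rewrite -sum1_card; apply: eq_bigl => u.
  by rewrite !inE.
nia.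
Qed.

(** Induction on the number of non-roots. The factor [#|T|] on the left avoids the exponent
    [#|T| - #|B| - 1], which would be negative when every vertex is a root. *)
Lemma card_forests B : (#|T| * #|roots_forests B| = #|B| * #|T| ^ (#|T| - #|B|))%N.
Proof.
have [m] := ubnP #|~: B|; elim: m B => // m IH B leB.
have [B0|[v]] := set_0Vmem (~: B).
  have -> : B = setT by rewrite -[B]setCK B0 setC0.
  rewrite cardsT subnn expn0; congr muln.
  apply/eqP/cards1P; exists [ffun x => x]; apply/setP => p; rewrite !inE.
  apply/andP/eqP => [[_ /eqP/setP pT]|->].
    by apply/ffunP => x; have := pT x; rewrite !inE ffunE => /eqP.
  split; first by apply/forestP => x; exists 0; rewrite /= ffunE.
  by apply/eqP/setP => x; rewrite !inE ffunE eqxx.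
rewrite inE => vB; have cB : (#|v |: B| = #|B|.+1)%N by rewrite cardsU1 vB.
have := card_forests_step vB; have := cardsC B; have := cardsC (v |: B).
have := IH (v |: B); rewrite cB => IHv cvB cB'.
have {IHv} : (#|T| * #|roots_forests (v |: B)| = #|B|.+1 * #|T| ^ (#|T| - #|B|.+1))%N.
  by apply: IHv; lia.
have -> : (#|T| - #|B| = (#|T| - #|B|.+1).+1)%N by lia.
rewrite expnS => IHv step.
suff : (#|B|.+1 * (#|T| * #|roots_forests B|) = #|B|.+1 * (#|B| * (#|T| * #|T| ^ (#|T| - #|B|.+1))))%N.
  by move/eqP; rewrite eqn_pmul2l // => /eqP.
rewrite mulnCA step; nia.
Qed.


(** * The order on idempotent maps, extended to forests *)

Definition below p a : bool := [forall x, (a (p x) == a x) && (p (a x) == a x)].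

(** For idempotent [a], the first equation says that [p] maps each block of [a] into itself, the
    second that [p] fixes the pointed elements of [a]. For [p = a] both say that [a] is
    idempotent. *)
Lemma belowP p a :
  reflect (forall x, a (p x) = a x /\ p (a x) = a x) (below p a).
Proof.
by apply: (iffP forallP) => pa x; have := pa x;
  [case/andP => /eqP ? /eqP | case=> -> ->; rewrite !eqxx].
Qed.

Definition sink_map p : {ffun T -> T} := [ffun x => sink p x].

Lemma fixset_sink_map p : forest p -> fixset (sink_map p) = fixset p.
Proof.
move=> fp; apply/setP => x; rewrite !inE ffunE; apply/eqP/eqP => [<-|].
  exact: sink_fixed.
exact: fixed_sink.
Qed.

Lemma below_sink_map p : forest p -> below (sink_map p) (sink_map p).
Proof.
by move=> fp; apply/belowP => x; rewrite !ffunE (fixed_sink (sink_fixed x fp)).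
Qed.

(** A forest can replace its sink map in the order: [x] and [p x] have the same sink, and a vertex
    equal to its sink is a root; conversely [a] is constant along the paths of [p]. *)
Lemma sink_map_below p a : forest p -> below (sink_map p) a = below p a.
Proof.
move=> fp; apply/belowP/belowP => pa x; split.
- have [] := pa (p x); rewrite ffunE sink_next // => <- _.
  by have [] := pa x; rewrite ffunE.
- have [_] := pa x; rewrite ffunE => ax.
  by have := sink_fixed (a x) fp; rewrite ax.
- by rewrite ffunE /sink; elim: #|T| => //= k; have [-> _] := pa (iter k p x).
- by rewrite ffunE fixed_sink //; have [] := pa x.
Qed.

(** * The sign-reversing involution on forests *)

Section SignReversing.

(* Deleting the edges into [r] makes the vertex [cut_vertex p] of the path from
   [x] either the sink of [x] (if that sink is not [r]) or the last vertex of
   that path before [r]. Toggling its edge to [r] does not change [unlink p],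
   hence neither [cut_vertex p]. *)
Variables (a : {ffun T -> T}) (x : T).
Hypotheses (aa : below a a) (ax : a x != x).
Let r := a x.

Definition unlink p : {ffun T -> T} := [ffun y => if p y == r then y else p y].
Definition cut_vertex p : T := sink (unlink p) x.
Definition toggle p : {ffun T -> T} :=
  redirect p (cut_vertex p) (if p (cut_vertex p) == r then cut_vertex p else r).

(** A vertex whose edge into [r] is deleted is at most one step from the root [r] in [p], and is a
    root of [unlink p]. The other edges agree, so paths end in one map exactly when they end in the
    other. *)
Lemma forest_unlink p : p r = r -> forest (unlink p) = forest p.
Proof.
move=> pr; apply/idP/idP => fp; apply/forestP; apply: (sink_ind fp) => y.
- rewrite ffunE; have [py _|_ py] := eqVneq (p y) r.
    by exists 1%N; rewrite /= py.
  by exists 0%N.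
- rewrite ffunE; have [py _|_ reach] := eqVneq (p y) r.
    by exists 1%N; rewrite /= py.
  exact: exists_next.
- by move=> py; exists 0%N; rewrite /= ffunE py if_same.
have [py _|py reach] := eqVneq (p y) r.
  by exists 0%N; rewrite /= ffunE py eqxx.
by apply: exists_next; rewrite {2 4}/unlink ffunE (negbTE py).
Qed.

Variable p : {ffun T -> T}.
Hypotheses (fp : forest p) (pa : below p a).

Lemma below_root : p r = r.
Proof. by have [] := belowP _ _ pa x. Qed.

Lemma a_cut_vertex : a (cut_vertex p) = r.
Proof.
rewrite /cut_vertex /sink; elim: #|T| => //= k IH; rewrite ffunE.
by case: ifP => // _; have [-> _] := belowP _ _ pa (iter k (unlink p) x).
Qed.

Lemma cut_vertex_neq : cut_vertex p != r.
Proof.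
rewrite /cut_vertex /sink; elim: #|T| => [|k IH] /=; first by rewrite eq_sym.
by rewrite ffunE; case: ifP => // /negbT.
Qed.

Lemma cut_vertexE : p (cut_vertex p) = r \/ p (cut_vertex p) = cut_vertex p.
Proof.
have fu : forest (unlink p) by rewrite forest_unlink ?below_root.
have := sink_fixed x fu; rewrite -/(cut_vertex p) ffunE.
by case: eqP; [left|right].
Qed.

Lemma unlink_toggle : unlink (toggle p) = unlink p.
Proof.
apply/ffunP => y; rewrite !ffunE; have [->|//] := eqVneq y (cut_vertex p).
have [pc|pc] := eqVneq (p (cut_vertex p)) r; first by rewrite if_same.
by rewrite eqxx; have [pr|->] := cut_vertexE; first by rewrite pr eqxx in pc.
Qed.

Lemma cut_vertex_toggle : cut_vertex (toggle p) = cut_vertex p.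
Proof. by rewrite /cut_vertex unlink_toggle. Qed.

Lemma toggleK : toggle (toggle p) = p.
Proof.
rewrite {1}/toggle cut_vertex_toggle redirect_redirect redirect_eq.
rewrite -[RHS](redirect_id p (cut_vertex p)); congr redirect.
have [-> /=|pc] := eqVneq (p (cut_vertex p)) r.
  by rewrite (negbTE cut_vertex_neq).
by rewrite eqxx; have [pr|->] := cut_vertexE; first by rewrite pr eqxx in pc.
Qed.

(** The cut vertex and [r] lie in the same block of [a], and the cut vertex is not pointed in [a],
    since [a] sends it to [r]. *)
Lemma below_toggle : below (toggle p) a.
Proof.
have paE := belowP _ _ pa; have aaE := belowP _ _ aa.
apply/belowP => y; rewrite !ffunE; split.
  have [->|_] := eqVneq y (cut_vertex p); last by have [] := paE y.
  by case: ifP => // _; rewrite a_cut_vertex /r; have [] := aaE x.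
have [ay|_] := eqVneq (a y) (cut_vertex p); last by have [] := paE y.
have [] := aaE y; rewrite ay a_cut_vertex => /eqP.
by rewrite eq_sym (negbTE cut_vertex_neq).
Qed.

Lemma forest_toggle : forest (toggle p).
Proof.
have tr : toggle p r = r.
  by have [_] := belowP _ _ below_toggle x.
by rewrite -(forest_unlink tr) unlink_toggle forest_unlink ?below_root.
Qed.

(** Only the cut vertex changes status: it is a root in exactly one of [p] and [toggle p]. *)
Lemma sign_toggle :
  (-1) ^+ #|~: fixset (toggle p)| = - (-1) ^+ #|~: fixset p| :> int.
Proof.
have card q : #|~: fixset q| =
    ((q (cut_vertex p) != cut_vertex p) + #|~: fixset q :\ cut_vertex p|)%N.
  by rewrite (cardsD1 (cut_vertex p)) !inE.
rewrite !card; have -> : ~: fixset (toggle p) :\ cut_vertex p = ~: fixset p :\ cut_vertex p.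
  apply/setP => y; rewrite !inE; have [//|yc] := eqVneq y (cut_vertex p).
  by rewrite /toggle redirect_neq.
rewrite /toggle redirect_eq !exprD; have [->|pc] := eqVneq (p (cut_vertex p)) r.
  by rewrite eqxx eq_sym cut_vertex_neq expr0 expr1 mul1r mulN1r opprK.
have [pr|->] := cut_vertexE; first by rewrite pr eqxx in pc.
by rewrite eqxx eq_sym cut_vertex_neq expr0 expr1 mul1r mulN1r.
Qed.

End SignReversing.

(** If [a] moves some [x], toggling is a sign-reversing involution of the forests below [a], so the
    sum equals its opposite. Below the identity there is only the identity. *)
Lemma sum_sign_below a : below a a ->
  \sum_(p | forest p && below p a) (-1) ^+ #|~: fixset p| = (fixset a == setT)%:R :> int.
Proof.
move=> aa; have [aT|] := eqVneq (fixset a) setT.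
  have aid y : a y = y by apply/eqP; have := in_setT y; rewrite -aT inE.
  rewrite (big_pred1 a) => [|p]; first by rewrite aT setCT cards0.
  apply/andP/eqP => [[_ /belowP pa]|->].
    by apply/ffunP => y; have [_] := pa y; rewrite aid.
  by split=> //; apply/forestP => y; exists 0%N; rewrite /= aid.
rewrite -subTset => /subsetPn[x _]; rewrite inE => ax.
set s := \sum_(p | _) _; suff : s = - s by lia.
rewrite {1}/s (reindex_onto (toggle a x) (toggle a x)) => [|p /andP[fp pa]]; last exact: toggleK.
rewrite -sumrN; apply: eq_big => [p|p /andP[/andP[fp pa] /eqP tK]].
  apply/idP/idP => [/andP[/andP[fp pa] /eqP <-]|/andP[fp pa]].
    by rewrite forest_toggle // below_toggle.
  by rewrite forest_toggle // below_toggle //= toggleK.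
by rewrite -[in RHS]tK [in RHS]sign_toggle ?opprK.
Qed.

End Forests.

(** * The generating polynomial of forests *)

Lemma sum_subsets_card (T : finType) (V : nmodType) (A : {set T}) (g : nat -> V) :
  \sum_(C : {set T} | C \subset A) g #|C| = \sum_(j < #|A|.+1) g j *+ 'C(#|A|, j).
Proof.
rewrite (partition_big (fun C : {set T} => inord #|C| : 'I_#|A|.+1) predT) //=.
apply: eq_bigr => j _; rewrite -[in RHS]cards_draws -sumr_const big_mkcond [RHS]big_mkcond /=.
apply: eq_bigr => C _; rewrite inE.
have [CA|//] := boolP (C \subset A).
have leC : (#|C| < #|A|.+1)%N by rewrite ltnS subset_leq_card.
by rewrite -val_eqE /= inordK //; case: eqP => // ->.
Qed.

(** Grouping by root sets [S :|: C] and applying [card_forests], which accounts for the factor [N],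
    gives the sum over [j] of ['C(m, j)] times [#|S| + j] times [t j]. The part with [#|S|] is a
    binomial expansion, the part with [j] is ['X] times its derivative. *)
Lemma forest_poly_scaled (T : finType) (S : {set T}) :
  let N := #|T| in let m := (N - #|S|)%N in
  (\sum_(p : {ffun T -> T} | forest p && (S \subset fixset p))
     (-1) ^+ #|~: fixset p| *: 'X^(#|fixset p| - #|S|)) *+ N =
  ('X - (N%:R)%:P) ^+ m *+ #|S| + 'X * ('X - (N%:R)%:P) ^+ m.-1 *+ m :> {poly int}.
Proof.
move=> N m; have cS : (#|S| + #|~: S| = N)%N by rewrite cardsC.
have mE : #|~: S| = m by rewrite /m -cS addKn.
pose t j : {poly int} := (- (N%:R)%:P) ^+ (m - j) * 'X^j.
have tE : ('X - (N%:R)%:P) ^+ m = \sum_(j < m.+1) t j *+ 'C(m, j) :> {poly int}.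
  by rewrite addrC exprDn.
have dE : 'X * ('X - (N%:R)%:P) ^+ m.-1 *+ m = \sum_(j < m.+1) t j *+ (j * 'C(m, j)) :> {poly int}.
  have -> : 'X * ('X - (N%:R)%:P) ^+ m.-1 *+ m = 'X * (('X - (N%:R)%:P) ^+ m)^`() :> {poly int}.
    by rewrite deriv_exp derivXsubC mul1r mulrnAr.
  rewrite tE raddf_sum mulr_sumr; apply: eq_bigr => j _.
  have tC : t j = ((- N%:R) ^+ (m - j))%:P * 'X^j by rewrite /t -polyCN polyC_exp.
  rewrite /= raddfMn /= tC mul_polyC derivZ derivXn -mul_polyC.
  case: (nat_of_ord j) => [|k] /=; first by rewrite !mulr0n !(mulr0, mul0rn).
  by rewrite exprS mulrnA !(mulrnAr, mulrnAl) -mul_polyC mulrCA.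
rewrite tE dE -[in RHS]sumrMnl -big_split /=.
transitivity (\sum_(j < m.+1) (t j *+ (#|S| + j)) *+ 'C(m, j)); last first.
  by apply: eq_bigr => j _; rewrite -!mulrnA -mulrnDr; congr (_ *+ _); lia.
rewrite -mE -(sum_subsets_card (~: S) (fun j => t j *+ (#|S| + j))).
rewrite (partition_big (@fixset T) (fun B => S \subset B)) => [|p /andP[]//].
rewrite (reindex_onto (fun C => S :|: C) (fun B => B :\: S)) /=; last first.
  by move=> B SB; rewrite setDE setUIr setUCr setIT; apply/setUidPr.
rewrite -sumrMnl; apply: eq_big => [C|C /andP[_ /eqP CE]].
  rewrite subsetUl setDUl setDv set0U -disjoints_subset.
  exact/eqP/setDidPl.
have cC : #|S :|: C| = (#|S| + #|C|)%N.
  by rewrite cardsU -{2}CE setDE setICA setICr setI0 cards0 subn0.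
have leC : (#|S :|: C| <= N)%N by apply: max_card.
rewrite (eq_bigr (fun=> (-1) ^+ (N - (#|S| + #|C|)) *: 'X^#|C|)); last first.
  move=> p /andP[_ /eqP fp]; rewrite fp cC addKn; congr (_ ^+ _ *: _).
  by have := cardsC (S :|: C); rewrite cC -/N; lia.
rewrite (eq_bigl (mem (roots_forests (S :|: C)))); last first.
  move=> p; rewrite /= inE -andbA; congr andb.
  by case: eqP => [->|]; rewrite ?subsetUl ?andbF.
rewrite sumr_const -mulrnA mulnC card_forests cC -/N /t.
have -> : (m - #|C| = N - (#|S| + #|C|))%N by rewrite /m subnDA.
rewrite mulnC mulrnA; congr (_ *+ _).
set k := (N - _)%N; rewrite -[- _%:P]mulN1r exprMn -polyC_exp -natrX -mul_polyC polyC_exp polyCN.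
by rewrite polyC1 polyC_natr mulrAC mulr_natr.
Qed.

(** With [m = #|T| - #|S| > 0], the two terms of [forest_poly_scaled] share the power [m - 1] of
    ['X - #|T|]; the cofactor [#|S| ('X - #|T|) + m 'X] equals [#|T| ('X - #|S|)], and [#|T|]
    cancels. *)
Lemma forest_poly (T : finType) (S : {set T}) : (#|S| < #|T|)%N ->
  \sum_(p : {ffun T -> T} | forest p && (S \subset fixset p))
     (-1) ^+ #|~: fixset p| *: 'X^(#|fixset p| - #|S|) =
  ('X - (#|S|%:R)%:P) * ('X - (#|T|%:R)%:P) ^+ (#|T| - 1 - #|S|) :> {poly int}.
Proof.
move=> ST; have N0 : #|T|%:R != 0 :> {poly int}.
  by rewrite -polyC_natr polyC_eq0 pnatr_eq0 -lt0n (leq_ltn_trans _ ST).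
apply: (mulIf N0); rewrite mulr_natr forest_poly_scaled.
have [k kE] : exists k, (#|T| - #|S| = k.+1)%N by exists (#|T| - #|S|).-1; lia.
rewrite kE (_ : #|T| - 1 - #|S| = k)%N; last lia.
have kN : (k.+1%:R : {poly int}) = #|T|%:R - #|S|%:R by rewrite -kE natrB // ltnW.
rewrite -[_ *+ #|S|]mulr_natr -[_ *+ k.+1]mulr_natr kN !polyC_natr exprS /=.
ring.
Qed.

Lemma forest_poly_setT (T : finType) :
  \sum_(p : {ffun T -> T} | forest p && ([set: T] \subset fixset p))
     (-1) ^+ #|~: fixset p| *: 'X^(#|fixset p| - #|T|) = 1 :> {poly int}.
Proof.
rewrite (big_pred1 [ffun x => x]) => [|p].
  have -> : fixset [ffun x : T => x] = setT by apply/setP => x; rewrite !inE ffunE eqxx.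
  by rewrite setCT cards0 cardsT subnn !expr0 scale1r.
rewrite subTset; apply/andP/eqP => [[_ /eqP/setP pT]|->].
  by apply/ffunP => x; have := pT x; rewrite !inE ffunE => /eqP.
split; first by apply/forestP => x; exists 0%N; rewrite /= ffunE.
by apply/eqP/setP => x; rewrite !inE ffunE eqxx.
Qed.

(** * Moebius function and rank in a poset with bottom *)

Section PosetLemmas.

Local Open Scope order_scope.

Variables (d : Order.disp_t) (T : finBPOrderType d).

(** The hypothesis expresses [F a] through the values strictly below [a] by the Moebius recursion;
    induct on the number of elements below. *)
Lemma mobius_bot_unique (F : T -> int) :
  (forall a, (\sum_(b | (b <= a)%O) F b = (a == \bot)%:R)%R) ->
  forall a, mobius \bot a = F a.
Proof.
move=> FE a; have [m] := ubnP #|[set z : T | z < a]|.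
elim: m a => // m IH a lea.
have := FE a; rewrite mobiusE (bigD1 a) //= eq_sym.
rewrite (eq_bigl (fun b => (\bot <= b) && (b < a))); last first.
  by move=> b; rewrite le0x lt_neqAle andbC.
rewrite (eq_bigr (mobius \bot)) => [|b /andP[_ ba]]; last first.
  rewrite IH // -ltnS; apply: leq_trans lea; rewrite ltnS; apply: proper_card; apply/properP; split.
    by apply/subsetP => t; rewrite !inE => tb; apply: lt_trans tb ba.
  by exists b; rewrite inE ?ltxx.
have [->|_] := eqVneq a \bot; last by move=> /eqP; rewrite addr_eq0 => /eqP ->.
by rewrite big_pred0 ?addr0 // => b; rewrite ltx0 andbF.
Qed.

(** On a chain below [a], [h] is injective with values less than [h a]. Conversely, descending one
    unit of [h] at a time builds a chain of [h a] elements. *)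
Lemma rank_height (h : T -> nat) :
  (forall a b, a < b -> (h a < h b)%N) ->
  (forall a, (0 < h a)%N -> exists2 b, b < a & h a = (h b).+1) ->
  forall a, rank a = h a.
Proof.
move=> hlt hcov a; apply/eqP; rewrite eqn_leq; apply/andP; split.
  apply/bigmax_leqP => C /andP[/forall_inP chC /forall_inP Ca].
  rewrite cardE -(size_map h) -(size_iota 0 (h a)); apply: uniq_leq_size.
    rewrite map_inj_in_uniq ?enum_uniq // => x y; rewrite !mem_enum => xC yC hxy.
    have cxy : x >=< y := forall_inP (chC x xC) y yC.
    by case: (comparable_ltgtP cxy) => // /hlt; rewrite hxy ltnn.
  by move=> _ /mapP[x xC ->]; rewrite mem_iota; apply/hlt/Ca; rewrite -mem_enum.
suff [C Cok <-] : exists2 C : {set T},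
    is_chain C && [forall x in C, x < a] & #|C| = h a by apply: leq_bigmax_cond.
move hk: (h a) => k; elim: k a hk => [|k IH] a hk.
  by exists set0; rewrite ?cards0 //; apply/andP; split; apply/forall_inP => x; rewrite inE.
have [|b ba hab] := hcov a; first by rewrite hk.
have [|C /andP[/forall_inP chC /forall_inP Cb] cC] := IH b; first by case: (etrans (esym hab) hk).
have bC : b \notin C by apply/negP => /Cb; rewrite ltxx.
exists (b |: C); last by rewrite cardsU1 bC cC.
apply/andP; split; last first.
  apply/forall_inP => x /setU1P[->//|/Cb xb]; exact: lt_trans xb ba.
apply/forall_inP => x /setU1P[->|xC]; apply/forall_inP => y /setU1P[->|yC].
- exact: comparablexx.
- by rewrite comparable_sym lt_comparable // Cb.
- by rewrite lt_comparable // Cb.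
- by have /forall_inP/(_ y yC) := chC x xC.
Qed.

End PosetLemmas.

(** * Posets of idempotent maps ordered by [below] *)

Lemma below_fixset (U : finType) (p q : {ffun U -> U}) :
  below p q -> fixset q \subset fixset p.
Proof.
move=> /belowP pq; apply/subsetP => x; rewrite !inE => /eqP qx.
by have [_] := pq x; rewrite qx => ->.
Qed.

(** [p x] is fixed by [p], hence by [q], so [p x = q (p x) = q x]. *)
Lemma below_fixset_eq (U : finType) (p q : {ffun U -> U}) :
  below p p -> below p q -> fixset p \subset fixset q -> p = q.
Proof.
move=> /belowP pp /belowP pq /subsetP fpq; apply/ffunP => x.
have [<- _] := pq x; have := fpq (p x); rewrite !inE => /implyP.
by have [-> _] := pp x; rewrite eqxx => /eqP.
Qed.

Section IdempotentPosets.

Variables (d : Order.disp_t) (T : finBPOrderType d) (U : finType).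
Variables (f : T -> {ffun U -> U}) (S : {set U}).
Hypothesis f_le : forall a b, (a <= b)%O = below (f a) (f b).
Hypothesis f_sub : forall a, S \subset fixset (f a).
Hypothesis f_surj : forall g, below g g -> S \subset fixset g -> exists a, f a = g.

Let f_idem a : below (f a) (f a).
Proof. by rewrite -f_le lexx. Qed.

Let f_inj : injective f.
Proof. by move=> a b ab; apply/eqP; rewrite eq_le !f_le ab f_idem. Qed.

Lemma fixset_eqT a : (fixset (f a) == setT) = (a == \bot%O).
Proof.
have [e eE] : exists e, f e = [ffun x => x].
  apply: f_surj; first by apply/belowP => x; rewrite !ffunE.
  by apply/subsetP => x _; rewrite inE ffunE.
have -> : \bot%O = e.
  apply/eqP; rewrite eq_le le0x /= f_le eE.
  by apply/belowP => x; rewrite !ffunE.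
apply/eqP/eqP => [aT|->]; last by apply/setP => x; rewrite eE !inE ffunE eqxx.
by apply: f_inj; apply/ffunP => x; have := in_setT x; rewrite -aT inE eE ffunE => /eqP.
Qed.

Lemma sum_forests_by_sink (V : nmodType) (P : pred {ffun U -> U}) (Q : pred T)
    (w : T -> {ffun U -> U} -> V) :
  (forall p a, forest p -> sink_map p = f a -> Q a = P p) ->
  \sum_(a | Q a) \sum_(p | forest p && (sink_map p == f a)) w a p =
  \sum_(p | forest p && P p) \sum_(a | f a == sink_map p) w a p.
Proof.
move=> QP; rewrite (exchange_big_dep (fun p => forest p && P p)) /=; last first.
  by move=> a p Qa /andP[fp /eqP sp]; rewrite fp -(QP p a).
apply: eq_bigr => p /andP[fp Pp]; apply: eq_bigl => a.
by rewrite fp /= eq_sym; case: eqP => [fa|]; rewrite ?andbF // (QP p a) // Pp.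
Qed.

(** [f] is a bijection onto the idempotent maps fixing [S], so exactly one term remains. *)
Lemma sum_sink_fiber (V : nmodType) (p : {ffun U -> U}) (w : T -> V) (v : V) :
  forest p -> S \subset fixset p -> (forall a, f a = sink_map p -> w a = v) ->
  \sum_(a | f a == sink_map p) w a = v.
Proof.
move=> fp Sp wv; have [a aE] : exists a, f a = sink_map p.
  by apply: f_surj; rewrite ?fixset_sink_map // below_sink_map.
by rewrite (big_pred1 a) ?wv // => b; rewrite -aE (inj_eq f_inj).
Qed.

(** Summed over all [b <= a], the right-hand side becomes the signed count of the forests below
    [f a], by [sink_map_below]; [sum_sign_below] evaluates it. *)
Lemma mobius_forests a :
  mobius \bot%O a = \sum_(p | forest p && (sink_map p == f a)) (-1) ^+ #|~: fixset p|.
Proof.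
apply: (@mobius_bot_unique _ _ (fun a => \sum_(p | forest p && (sink_map p == f a)) _)) => {}a.
have below_sub p : forest p -> below p (f a) -> S \subset fixset p.
  by move=> fp pa; apply: subset_trans (f_sub a) (below_fixset pa).
rewrite (sum_forests_by_sink (P := fun p => below p (f a))) //; last first.
  by move=> p b fp pb; rewrite f_le -pb sink_map_below.
rewrite -fixset_eqT -sum_sign_below //; apply: eq_bigr => p /andP[fp pa].
by apply: sum_sink_fiber => //; apply: below_sub.
Qed.

Lemma rank_fixset a : rank a = #|~: fixset (f a)|.
Proof.
apply: (@rank_height _ _ (fun a => #|~: fixset (f a)|)) => {a} [a b ab|a].
  apply: proper_card; rewrite properC properEneq below_fixset -?f_le ?ltW // andbT.
  apply/eqP => fab; suff eab : a = b by rewrite eab ltxx in ab.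
  by apply/f_inj/below_fixset_eq; rewrite ?fab ?subxx -?f_le ?lexx ?ltW.
rewrite card_gt0 => /set0Pn[x]; rewrite !inE => ax.
have aE := belowP _ _ (f_idem a).
have ax' y : f a y != x by apply: contra ax => /eqP <-; have [->] := aE y.
(* Split the non-pointed [x] off as a singleton block; the map stays idempotent because [x] is not
   in the image of [f a]. *)
have [||b bE] := @f_surj (redirect (f a) x x).
- apply/belowP => y; rewrite !ffunE; have [_|_] := eqVneq y x; first by rewrite eqxx.
  by rewrite (negbTE (ax' y)); have [-> _] := aE y.
- apply: subset_trans (f_sub a) _; apply/subsetP => y; rewrite !inE ffunE => /eqP ay.
  by have [yx|_] := eqVneq y x; rewrite ?ay ?yx.
have bfix : ~: fixset (f b) = ~: fixset (f a) :\ x.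
  by apply/setP => y; rewrite bE !inE ffunE; have [yx|_] := eqVneq y x; rewrite ?yx ?eqxx.
exists b; last by rewrite bfix (cardsD1 x) !inE ax.
rewrite lt_neqAle f_le; apply/andP; split.
  apply: contraNneq ax => ba; move: bE; rewrite ba => /ffunP/(_ x).
  by rewrite redirect_eq => ->.
apply/belowP => y; rewrite bE !ffunE (negbTE (ax' y)).
by have [ay _] := aE y; rewrite ay; have [->|_] := eqVneq y x; rewrite ?ay.
Qed.

Lemma poset_rank_fixset (g : {ffun U -> U}) :
  below g g -> S \subset fixset g ->
  (forall a, #|fixset g| <= #|fixset (f a)|)%N ->
  poset_rank T = #|~: fixset g|.
Proof.
move=> gg Sg gmin; have [a aE] := f_surj gg Sg.
apply/eqP; rewrite eqn_leq; apply/andP; split.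
  apply/bigmax_leqP => b _; rewrite rank_fixset.
  by have := cardsC (fixset g); have := cardsC (fixset (f b)); have := gmin b; lia.
by rewrite -aE -rank_fixset; apply: leq_bigmax.
Qed.

Lemma characteristic_poly_forests :
  characteristic_poly T = \sum_(p : {ffun U -> U} | forest p && (S \subset fixset p))
     (-1) ^+ #|~: fixset p| *: 'X^(poset_rank T - #|~: fixset p|).
Proof.
rewrite /characteristic_poly.
under eq_bigr => a _ do rewrite mobius_forests scaler_suml.
rewrite (sum_forests_by_sink (P := fun p => S \subset fixset p)) //; last first.
  by move=> p a fp pa; rewrite -(fixset_sink_map fp) pa f_sub.
apply: eq_bigr => p /andP[fp Sp]; apply: sum_sink_fiber => // a aE.
by rewrite rank_fixset aE fixset_sink_map.
Qed.

End IdempotentPosets.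

(** * Pointed partitions as idempotent maps *)

Section PointMap.

Variable n : nat.
Implicit Types (a b : pointed_partition n) (x y : 'I_n).

Let transv a : is_transversal (pointed a) (blocks a) [set: 'I_n].
Proof. by have /andP[] := pp_valP a. Qed.

Let triv a : trivIset (blocks a).
Proof. by have /and3P[] := blocks_partition a. Qed.

Let pblock_blocks a x : pblock (blocks a) x \in blocks a.
Proof. by rewrite pblock_mem // (cover_partition (blocks_partition a)). Qed.

Let mem_own a x : x \in pblock (blocks a) x.
Proof. by rewrite mem_pblock (cover_partition (blocks_partition a)). Qed.

Definition point a : {ffun 'I_n -> 'I_n} :=
  [ffun x => transversal_repr x (pointed a) (pblock (blocks a) x)].

Lemma point_pointed a x : point a x \in pointed a.
Proof. by rewrite ffunE (repr_mem_transversal (transv a)). Qed.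

Lemma point_pblock a x : point a x \in pblock (blocks a) x.
Proof. by rewrite ffunE (repr_mem_pblock (transv a)). Qed.

Lemma fixset_point a : fixset (point a) = pointed a.
Proof.
apply/setP => x; rewrite inE; apply/eqP/idP => [<-|xa]; first exact: point_pointed.
by rewrite ffunE (pblockK (transv a)).
Qed.

Lemma point_fixed a x : x \in pointed a -> point a x = x.
Proof. by rewrite -fixset_point inE => /eqP. Qed.

Lemma point_eq a x y : (point a x == point a y) = (y \in pblock (blocks a) x).
Proof.
rewrite -eq_pblock ?(cover_partition (blocks_partition a)) //.
apply/eqP/eqP => [xy|xy].
  rewrite -(same_pblock (triv a) (point_pblock a x)) xy.
  by rewrite (same_pblock (triv a) (point_pblock a y)).
apply: (pblock_inj (transv a)); rewrite ?point_pointed //.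
by rewrite (same_pblock (triv a) (point_pblock a x)) xy (same_pblock (triv a) (point_pblock a y)).
Qed.

(** Refinement matches [point b (point a x) = point b x], and inclusion of pointed sets matches
    [point a (point b x) = point b x]. *)
Lemma le_point a b : (a <= b)%O = below (point a) (point b).
Proof.
apply/andP/belowP => [[/forall_inP ab /subsetP pab] x|ab]; split.
- have [C Cb sC] := exists_inP (ab _ (pblock_blocks a x)).
  apply/eqP; rewrite point_eq (def_pblock (triv b) Cb) ?(subsetP sC) //.
  exact: point_pblock.
- by rewrite point_fixed // pab // point_pointed.
- apply/forall_inP => B Ba; apply/exists_inP.
  have [x xB] : exists x, x \in B.
    apply/set0Pn; have /and3P[_ _] := blocks_partition a.
    by apply: contraNneq => <-.
  exists (pblock (blocks b) x); first exact: pblock_blocks.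
  apply/subsetP => y yB; rewrite -point_eq; have [<- _] := ab x; have [<- _] := ab y.
  suff -> : point a x = point a y by [].
  by apply/eqP; rewrite point_eq (def_pblock (triv a) Ba xB).
- apply/subsetP => x /point_fixed xb; rewrite -fixset_point inE -xb.
  by have [_ ->] := ab x.
Qed.

(** Take the fibres of [g] as blocks; each contains exactly one fixed point, the common value of [g]
    on it. *)
Lemma point_surj (g : {ffun 'I_n -> 'I_n}) : below g g -> exists a, point a = g.
Proof.
move=> /belowP gg; pose P := preim_partition g [set: 'I_n].
have partP : partition P setT := preim_partitionP g setT.
have tP : trivIset P by have /and3P[] := partP.
have PE x y : (y \in pblock P x) = (g x == g y).
  rewrite pblock_equivalence_partition ?inE // => u v w _ _ _.
  by split=> // /eqP ->.
have ok : is_pointed_partition (P, fixset g).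
  rewrite /is_pointed_partition partP /= /is_transversal partP subsetT /=.
  apply/forall_inP => B BP; have [x xB] : exists x, x \in B.
    apply/set0Pn; have /and3P[_ _] := partP.
    by apply: contraNneq => <-.
  apply/cards1P; exists (g x); apply/setP => y.
  rewrite -(def_pblock tP BP xB) in_setI PE !inE; apply/andP/eqP => [[/eqP + /eqP ->]|->].
    by [].
  by have [-> _] := gg x.
exists (PointedPartition ok); apply/ffunP => x.
have := point_pblock (PointedPartition ok) x; rewrite -[blocks _]/P PE => /eqP ->.
have := point_pointed (PointedPartition ok) x.
by rewrite -[pointed _]/(fixset g) inE => /eqP.
Qed.

End PointMap.

(** * The characteristic polynomials of the two posets *)

Unset Implicit Arguments.

Theorem theorem1p3 (n : nat) (hn : (1 <= n)%N) :
  (forall i : nat, (1 <= i <= n)%N ->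
     characteristic_poly (pointed_partition_in n i) =
       (if i == n then 1
        else ('X - (i%:R)%:P) * ('X - (n%:R)%:P) ^+ (n - 1 - i)%N)
     /\ ((characteristic_poly (pointed_partition_in n i))`_0)%:~R =
          (-1) ^+ (n - i)%N * i%:R * n%:R ^ (n%:Z - 1 - i%:Z) :> rat)
  /\ characteristic_poly (pointed_partition n) = ('X - (n%:R)%:P) ^+ (n - 1)%N.
Proof.
pose x0 : 'I_n := Ordinal hn.
split=> [i /andP[i0 iN]|]; last first.
  (* One block pointed at [x0]: the fewest pointed elements, hence maximal rank. *)
  pose g : {ffun 'I_n -> 'I_n} := [ffun=> x0].
  have gE : fixset g = [set x0] by apply/setP => x; rewrite !inE ffunE eq_sym.
  have p_le (a b : pointed_partition n) : (a <= b)%O = below (point a) (point b).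
    exact: le_point.
  have p_sub (a : pointed_partition n) : set0 \subset fixset (point a) by apply: sub0set.
  have p_surj (h : {ffun 'I_n -> 'I_n}) : below h h -> set0 \subset fixset h -> exists a, point a = h.
    by move=> hh _; apply: point_surj.
  have rE : poset_rank (pointed_partition n) = (n - 1)%N.
    have gg : below g g by apply/belowP => x; rewrite !ffunE.
    have gmin (a : pointed_partition n) : (#|fixset g| <= #|fixset (point a)|)%N.
      rewrite gE cards1 card_gt0; apply/set0Pn; exists (point a x0).
      by rewrite fixset_point point_pointed.
    rewrite (poset_rank_fixset p_le p_sub p_surj gg (sub0set _) gmin).
    by have := cardsC (fixset g); rewrite gE cards1 card_ord; lia.
  rewrite (characteristic_poly_forests p_le p_sub p_surj).
  (* [forest_poly] with empty [S] has ['X^#|fixset p|], one power more than here, and its value has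
     the matching factor ['X]. *)
  apply: (@mulfI _ 'X); first by rewrite polyX_eq0.
  rewrite mulr_sumr rE.
  have := @forest_poly 'I_n set0; rewrite cards0 card_ord subr0 subn0 => <- //.
  apply: eq_bigr => p /andP[fp _]; rewrite -scalerAr -exprS; congr (_ *: 'X^_).
  (* A root exists, so the truncated subtraction in the exponent is exact. *)
  have : (0 < #|fixset p|)%N.
    by rewrite card_gt0; apply/set0Pn; exists (sink p x0); rewrite inE sink_fixed.
  have := cardsC (fixset p); rewrite card_ord; move: #|fixset p| #|~: fixset p| => u v; lia.
pose S := [set j : 'I_n | (j < i)%N].
have cS : #|S| = i.
  by rewrite cardsE -sum1_card big_ord_narrow // sum1_card card_ord.
pose f (a : pointed_partition_in n i) := point (val a).
have f_le a b : (a <= b)%O = below (f a) (f b) by rewrite leEsub le_point.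
have f_sub a : S \subset fixset (f a) by rewrite fixset_point; apply: (valP a).
have f_surj (h : {ffun 'I_n -> 'I_n}) : below h h -> S \subset fixset h -> exists a, f a = h.
  move=> /point_surj[a <-]; rewrite fixset_point => Sa.
  by exists (PointedPartitionIn Sa).
have charE : characteristic_poly (pointed_partition_in n i) =
    \sum_(p : {ffun 'I_n -> 'I_n} | forest p && (S \subset fixset p))
      (-1) ^+ #|~: fixset p| *: 'X^(#|fixset p| - #|S|).
  have rE : poset_rank (pointed_partition_in n i) = (n - i)%N.
    (* Everything outside [S] joins the block of [x0], which lies in [S] because [1 <= i]; only [S]
       remains pointed. *)
    pose g : {ffun 'I_n -> 'I_n} := [ffun x => if x \in S then x else x0].
    have x0S : x0 \in S by rewrite inE /=.
    have gE : fixset g = S.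
      apply/setP => x; rewrite inE ffunE; case: ifP => xS; first exact: eqxx.
      by apply: contraFF xS => /eqP <-.
    have gg : below g g.
      by apply/belowP => x; rewrite !ffunE; have [xS|xS] := boolP (x \in S); rewrite ?x0S ?xS.
    have Sg : S \subset fixset g by rewrite gE.
    have gmin a : (#|fixset g| <= #|fixset (f a)|)%N by rewrite gE subset_leq_card.
    rewrite (poset_rank_fixset f_le f_sub f_surj gg Sg gmin).
    by have := cardsC (fixset g); rewrite gE cS card_ord; lia.
  rewrite (characteristic_poly_forests f_le f_sub f_surj) rE.
  apply: eq_bigr => p /andP[_ /subset_leq_card]; rewrite cS => ip.
  by congr (_ *: 'X^_); have := cardsC (fixset p); rewrite card_ord; lia.
have polyE : characteristic_poly (pointed_partition_in n i) =
       (if i == n then 1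
        else ('X - (i%:R)%:P) * ('X - (n%:R)%:P) ^+ (n - 1 - i)%N).
  rewrite charE; have [ni|ni] := eqVneq i n.
    have -> : S = setT.
      by apply/setP => j; rewrite !inE ni ltn_ord.
    by rewrite cardsT forest_poly_setT.
  by rewrite forest_poly cS card_ord // ltn_neqAle ni.
split=> //; rewrite polyE.
have n0 : n%:R != 0 :> rat by rewrite pnatr_eq0 -lt0n.
have [->|ni] := eqVneq i n.
  (* For [i = n] the claimed constant term is [n] times [n ^ (-1)]. *)
  rewrite coef1 subnn expr0 mul1r (_ : n%:Z - 1 - n%:Z = -1); last by lia.
  by rewrite exprN1 divff.
rewrite -horner_coef0 !hornerE (_ : n%:Z - 1 - i%:Z = (n - 1 - i)%N%:Z); last by lia.
(* The additional sign comes from the factor [- i]. *)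
rewrite (_ : n - i = (n - 1 - i).+1)%N; last by lia.
rewrite -exprnP; move: (n - 1 - i)%N => k.
rewrite -[- n%:R]mulN1r exprMn exprS !rmorphM rmorphN !rmorphXn !rmorphN /= !rmorph_nat.
by rewrite rmorph1; ring.
Qed.
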